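(* Let $T_5(n)=(5n+1)/2$ for odd $n$ and $T_5(n)=n/2$ for even $n$. For $\lambda\ge1$ and a positive integer $n$ define the $\lambda^+$-stopping time $$\sigma^+_\lambda(n)=\inf\{k\ge 0:\ T_5^{(k)}(n)/n>\lambda\}$$ (with $\sigma^+_\lambda(n)=+\infty$ if no such $k$ exists), and for $k\ge1$ let $S^+_\lambda(k)=\{n\ge1:\sigma^+_\lambda(n)\le k\}$. Then for every fixed $\lambda\ge1$: (i) for each $k\ge 1$ the set $S^+_\lambda(k)$ has a natural density $\mathbb D(S^+_\lambda(k))$; (ii) $\lim_{k\to\infty}\mathbb D(S^+_\lambda(k))=1$; in particular the set of positive integers with finite $\lambda^+$-stopping time has natural density $1$.
   Context: $T_5^{(k)}$ denotes the $k$-th iterate of $T_5$. The natural density of $\Sigma\subset\{1,2,3,\dots\}$ is $\mathbb D(\Sigma)=\lim_{t\to\infty}\frac1t\#\{n\in\Sigma:n\le t\}$ when the limit exists. *)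

(* Defs.v *)
From mathcomp Require Import all_boot all_order all_algebra.
From mathcomp Require Import all_classical all_reals all_analysis.
Set Implicit Arguments.
Unset Strict Implicit.
Unset Printing Implicit Defensive.
Import Order.TTheory GRing.Theory Num.Theory.
Import numFieldNormedType.Exports.

Local Open Scope classical_set_scope.
Local Open Scope ring_scope.

Definition T5 (n : nat) : nat :=
  if odd n then ((5 * n + 1) %/ 2)%N else (n %/ 2)%N.

(* Extended-real valued, so that the infimum of the empty set is +oo. *)
Definition stopping_time (R : realType) (lambda : R) (n : nat) : \bar R :=
  ereal_inf [set (k%:R)%:E | k in
               [set k : nat | (iter k T5 n)%:R / n%:R > lambda]].

Definition stopping_set (R : realType) (lambda : R) (k : nat) : set nat :=
  [set n | (1 <= n)%N /\ (stopping_time lambda n <= (k%:R)%:E)%E].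

Definition finite_stopping_set (R : realType) (lambda : R) : set nat :=
  [set n | (1 <= n)%N /\ (stopping_time lambda n < +oo)%E].

(* iota 1 t = [:: 1; ...; t]; the value at t = 0 is irrelevant to the limit. *)
Definition count_ratio (R : realType) (A : set nat) (t : nat) : R :=
  (count (fun n => n \in A) (iota 1 t))%:R / t%:R.

Definition has_natural_density (R : realType) (A : set nat) : Prop :=
  cvgn (@count_ratio R A).

(* Meaningful only under has_natural_density, as lim is total. *)
Definition natural_density (R : realType) (A : set nat) : R :=
  limn (@count_ratio R A).

(* Main.v *)
Require Import Defs.
From mathcomp Require Import all_boot all_order all_algebra.
From mathcomp Require Import all_classical all_reals all_analysis.
From mathcomp Require Import zify ring lra.
Import Order.TTheory GRing.Theory Num.Theory.
Import numFieldNormedType.Exports.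

Local Open Scope classical_set_scope.
Local Open Scope ring_scope.

(** Let [s] be the number of odd iterates among the first [k] of [n].  Then [s]
    only depends on [n] modulo [2 ^ k], and [T5^k (n + m 2^k) = T5^k n + m 5^s].
    So on each class modulo [2 ^ k] the inequalities [T5^j n > lambda n], [j <= k],
    compare affine functions of [m], and the stopping set is eventually periodic,
    hence has a density.  For (ii), [T5^k n >= 5^s n / 2^k], so [n] can only be
    missed if [5^s <= lambda 2^k].  Exactly one of [n], [n + 2^k] has an odd
    [k]-th iterate, so the weights [a^(k-s) b^s] add up to [(a+b)^k] on every
    window of length [2 ^ k].  Taking [a^4 >= 2], [b^4 >= 2/5] and [a + b < 2]
    (possible because [2 * (2/5) < 1]), every missed [n] has weight at least
    [1/lambda], and the missed density is at most [lambda ((a+b)/2)^k]. *)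

(** * Iterates of [T5] along residue classes modulo powers of 2 *)

Definition odd_steps (k n : nat) : nat := (\sum_(j < k) odd (iter j T5 n))%N.

Lemma odd_stepsS k n :
  odd_steps k.+1 n = (odd_steps k n + odd (iter k T5 n))%N.
Proof. by rewrite /odd_steps big_ord_recr. Qed.

Lemma odd_steps_le k n : (odd_steps k n <= k)%N.
Proof.
elim: k => [|k IHk]; first by rewrite /odd_steps big_ord0.
by rewrite odd_stepsS; case: odd; lia.
Qed.

Lemma T5_add_double x y :
  T5 (x + 2 * y) = (T5 x + y * 5 ^ odd x)%N.
Proof.
rewrite /T5 oddD oddM /= addbF.
by case: ifP => ox; rewrite ?expn1 ?expn0; lia.
Qed.

Lemma iter_T5_shift k n m :
  (iter k T5 (n + m * 2 ^ k) = iter k T5 n + m * 5 ^ odd_steps k n)%N /\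
  odd_steps k (n + m * 2 ^ k) = odd_steps k n.
Proof.
elim: k m => [|k IHk] m; first by rewrite /odd_steps !big_ord0 !expn0 muln1.
(* A shift by [m * 2 ^ k.+1] is [2 * m] shifts by [2 ^ k], so it moves the [k]-th iterate by an even
   amount and keeps its parity. *)
have [IH1 IH2] := IHk (2 * m)%N.
have -> : (n + m * 2 ^ k.+1 = n + 2 * m * 2 ^ k)%N by rewrite expnS; ring.
rewrite !odd_stepsS IH2 !iterS IH1 -mulnA; split.
  by rewrite T5_add_double expnD mulnA.
by rewrite oddD oddM /= addbF.
Qed.

(** An even step halves exactly; an odd step multiplies by more than 5/2, the [+ 1] being
    dropped. *)
Lemma iter_T5_ge k n :
  (5 ^ odd_steps k n * n <= 2 ^ k * iter k T5 n)%N.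
Proof.
elim: k => [|k IHk]; first by rewrite /odd_steps big_ord0.
rewrite odd_stepsS expnD iterS.
have : (5 ^ odd (iter k T5 n) * iter k T5 n <= 2 * T5 (iter k T5 n))%N.
  by rewrite /T5; case: ifP => o; rewrite ?expn1 ?expn0; lia.
move: (iter k T5 n) IHk => x IHk; rewrite expnS.
move: (5 ^ odd_steps k n)%N (5 ^ odd x)%N (2 ^ k)%N (T5 x) IHk => u v w y.
by nia.
Qed.

(** * Multiplicative weights on parity patterns *)

Section Weights.
Variables (R : realType) (a b : R).

Definition parity_weight (k n : nat) : R :=
  a ^+ (k - odd_steps k n) * b ^+ odd_steps k n.

Lemma parity_weightS k n :
  parity_weight k.+1 n =
  parity_weight k n * (if odd (iter k T5 n) then b else a).
Proof.
rewrite /parity_weight odd_stepsS; have := odd_steps_le k n.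
case: odd => le_k.
  by rewrite addn1 subSS exprSr mulrA.
by rewrite addn0 subSn // exprSr mulrAC.
Qed.

Lemma sum_parity_weight k t :
  \sum_(i < 2 ^ k) parity_weight k (t + i) = (a + b) ^+ k.
Proof.
elim: k => [|k IHk].
  rewrite expn0 big_ord_recl big_ord0 /parity_weight /odd_steps big_ord0.
  by rewrite !expr0 mulr1 addr0.
rewrite expnS mul2n -addnn big_split_ord /= -big_split /= exprSr -IHk mulr_suml.
apply: eq_bigr => i _; rewrite !parity_weightS.
(* Shifting by [2 ^ k] keeps the weight of the first [k] steps but adds a power of 5, an odd number,
   to the [k]-th iterate: one point of the pair gains [a], the other [b]. *)
have [] := iter_T5_shift k (t + i) 1.
rewrite !mul1n -addnA [(i + _)%N]addnC => it_shift os_shift.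
rewrite {2}/parity_weight os_shift -/(parity_weight k _) it_shift oddD oddX orbT.
by rewrite addbT; case: odd; rewrite /= -mulrDr // addrC.
Qed.

End Weights.

(** * Density of eventually periodic sets *)

Section EventuallyPeriodic.
Variables (R : realType) (A : set nat) (p N : nat).
Hypothesis p_gt0 : (0 < p)%N.
Hypothesis A_periodic : forall n, (N <= n)%N -> ((n + p)%N \in A) = (n \in A).

Lemma count_iota (P : pred nat) m n :
  count P (iota m n) = (\sum_(i < n) P (m + i))%N.
Proof.
elim: n m => [|n IHn] m; first by rewrite big_ord0.
rewrite big_ord_recl /= IHn addn0; congr (_ + _)%N.
by apply: eq_bigr => i _; rewrite /bump /= addnCA add1n addSn.
Qed.

Lemma window_count_const t : (N <= t)%N ->
  (\sum_(i < p) (t + i \in A) = \sum_(i < p) (N + i \in A))%N.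
Proof.
elim: t => [|t IHt]; first by rewrite leqn0 => /eqP ->.
rewrite leq_eqVlt => /predU1P[-> //|]; rewrite ltnS => le_Nt.
rewrite -IHt //; case: p p_gt0 A_periodic => // q _ perA.
rewrite big_ord_recr big_ord_recl /= addn0 addSn -addnS perA // addnC.
by congr (_ + _)%N; apply: eq_bigr => i _; rewrite /bump /= addnCA add1n addSn.
Qed.

Let C := (\sum_(i < p) (N + i \in A))%N.

Lemma count_add_period t : (N <= t)%N ->
  (count (fun n => n \in A) (iota 1 (t + p)) =
   count (fun n => n \in A) (iota 1 t) + C)%N.
Proof.
move=> le_Nt; rewrite iotaD count_cat; congr (_ + _)%N.
by rewrite count_iota window_count_const // add1n ltnW.
Qed.

(** The gap [f] between the count and its linear growth is [p]-periodic from [N] on, hence bounded,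
    and vanishes after division by [t]. *)
Lemma count_ratio_periodic :
  count_ratio R A @ \oo --> (C%:R / p%:R : R).
Proof.
pose f t : R :=
  (count (fun n => n \in A) (iota 1 t))%:R - t%:R * (C%:R / p%:R).
have pn0 : p%:R != 0 :> R by rewrite pnatr_eq0 -lt0n.
have fper t : (N <= t)%N -> f (t + p)%N = f t.
  by move=> le_Nt; rewrite /f count_add_period // !natrD; field.
pose B := \sum_(i < N + p) `|f i|.
have B_ge0 : 0 <= B by apply: sumr_ge0.
have fB t : `|f t| <= B.
  elim/ltn_ind: t => t IHt; case: (ltnP t (N + p)) => [lt_t|ge_t].
    by rewrite /B (bigD1 (Ordinal lt_t)) //= lerDl sumr_ge0.
  have -> : t = (t - p + p)%N by lia.
  by rewrite fper; [apply: IHt; lia | lia].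
apply/cvgrPdist_le => e e0; near=> t.
have t0 : 0 < t%:R :> R by rewrite ltr0n; near: t; exact: nbhs_infty_gt.
have -> : C%:R / p%:R - count_ratio R A t = - (f t / t%:R).
  by rewrite /count_ratio /f; field; rewrite pn0 gt_eqF.
rewrite normrN normf_div (gtr0_norm t0) ler_pdivrMr // (le_trans (fB t)) //.
rewrite mulrC -ler_pdivrMr //; near: t; exact: nbhs_infty_ger.
Unshelve. all: end_near. Qed.

End EventuallyPeriodic.

(** * Periodicity and density of the stopping sets *)

Section StoppingSet.
Variables (R : realType) (lambda : R).

Lemma stopping_setP k n :
  stopping_set lambda k n <->
  (0 < n)%N /\ exists j : 'I_k.+1, lambda * n%:R < (iter j T5 n)%:R.
Proof.
split=> -[n0 H]; split=> //.
  apply: contrapT => noj.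
  (* Times are integers, so if none is at most [k], the infimum is at least [k.+1]; the empty set is
     included. *)
  suff : ((k.+1%:R)%:E <= stopping_time lambda n)%E.
    by move=> /le_trans/(_ H); rewrite lee_fin ler_nat ltnn.
  apply: le_ereal_inf_tmp => _ [j /= ltj <-]; rewrite lee_fin ler_nat ltnNge.
  apply/negP => le_jk; apply: noj; exists (Ordinal (le_jk : (j < k.+1)%N)) => /=.
  by rewrite -ltr_pdivlMr // ltr0n.
case: H => j ltj; apply: (@le_trans _ _ ((j : nat)%:R)%:E).
  by apply: ereal_inf_lbound; exists (j : nat) => //=; rewrite ltr_pdivlMr // ltr0n.
by rewrite lee_fin ler_nat -ltnS.
Qed.

Lemma affine_sign_eventually (x d : R) :
  \forall m \near \oo, (0 < x + m%:R * d) = (0 < x + m.+1%:R * d).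
Proof.
have big (e : R) : \forall m \near \oo, e <= m%:R by exact: nbhs_infty_ger.
case: (ltrgt0P d) => d0.
- near=> m.
  have : (- x + 1) / d <= m%:R by near: m; exact: big.
  by rewrite ler_pdivrMr // -natr1 mulrDl => h; apply/idP/idP => _; lra.
- near=> m.
  have : (x + 1) / - d <= m%:R by near: m; exact: big.
  rewrite ler_pdivrMr ?oppr_gt0 // -natr1 mulrDl => h.
  by apply/idP/idP => h'; lra.
- by near=> m; rewrite d0 !mulr0.
Unshelve. all: end_near. Qed.

Lemma stopping_set_eventually_periodic k :
  exists N, forall n, (N <= n)%N ->
    ((n + 2 ^ k)%N \in stopping_set lambda k) = (n \in stopping_set lambda k).
Proof.
pose p := (2 ^ k)%N; have p0 : (0 < p)%N by rewrite expn_gt0.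
pose P j n := lambda * n%:R < (iter j T5 n)%:R.
have : \forall m \near \oo, forall ij : 'I_p * 'I_k.+1,
    P ij.2 (ij.1 + m * p)%N = P ij.2 (ij.1 + m.+1 * p)%N.
  apply: filter_forall => -[i j] /=.
  pose s := odd_steps j i.
  have PE m : P j (i + m * p)%N =
      (0 < (iter j T5 i)%:R - lambda * i%:R +
           m%:R * ((2 ^ (k - j))%:R * (5 ^ s)%:R - lambda * p%:R)).
    rewrite /P.
    (* Since [j <= k], the period [2 ^ k] is a multiple of [2 ^ j], and the shift lemma applies at
       level [j]. *)
    have -> : (i + m * p = i + (m * 2 ^ (k - j)) * 2 ^ j)%N.
      by rewrite -mulnA -expnD subnK // -ltnS.
    have [-> _] := iter_T5_shift j i (m * 2 ^ (k - j)).
    rewrite -subr_gt0 -/s; congr (0 < _).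
    have -> : p%:R = (2 ^ (k - j) * 2 ^ j)%:R :> R by rewrite -expnD subnK // -ltnS.
    by rewrite !natrD !natrM; ring.
  by apply: filterS (affine_sign_eventually _ _) => m; rewrite !PE; apply.
(* The successor ensures [0 < n], which membership requires. *)
case=> M _ HM; exists (M * p).+1 => n le_n.
have n0 : (0 < n)%N by lia.
have Pn (j : 'I_k.+1) : P j (n + p)%N = P j n.
  have le_M : (M <= n %/ p)%N by rewrite leq_divRL // ltnW.
  have lt_p : (n %% p < p)%N by rewrite ltn_mod.
  have /= := HM _ le_M (Ordinal lt_p, j).
  by rewrite mulSn (addnC p) addnA [(n %% p + _)%N]addnC -divn_eq => ->.
apply/idP/idP; rewrite !inE => /stopping_setP[_ [j Hj]]; apply/stopping_setP.
  by split=> //; exists j; rewrite -[_ < _]/(P j n) -Pn.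
by split; [rewrite addn_gt0 n0 | exists j; rewrite -[_ < _]/(P j (n + p)%N) Pn].
Qed.

(** On the right each even step contributes [a ^+ 4] and each odd step [5 * b ^+ 4], both at least
    2. *)
Lemma parity_weight_pow4_ge (a b : R) k n : 0 <= a -> 0 <= b ->
  2 <= a ^+ 4 -> 2 <= 5 * b ^+ 4 ->
  2 ^+ k <= 5 ^+ odd_steps k n * parity_weight R a b k n ^+ 4.
Proof.
move=> a0 b0 ha hb.
rewrite /parity_weight; have le_s := odd_steps_le k n; set s := odd_steps k n in le_s *.
have -> : 5 ^+ s * (a ^+ (k - s) * b ^+ s) ^+ 4 =
    (a ^+ 4) ^+ (k - s) * (5 * b ^+ 4) ^+ s.
  by rewrite (exprMn _ 5) (exprAC a) (exprAC b); ring.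
rewrite -{1}(subnK le_s) exprD.
by apply: ler_pM; rewrite ?exprn_ge0 //; apply: lerXn2r;
  rewrite ?nnegrE ?mulr_ge0 ?exprn_ge0.
Qed.

Hypothesis hlambda : 1 <= lambda.

(** Rational upper approximations of the fourth roots of 2 and 2/5, close enough that
    [a + b = 1.996 < 2]. *)
Let a : R := 6 / 5.
Let b : R := 199 / 250.

Lemma missed_weight k n : (0 < n)%N -> n \notin stopping_set lambda k ->
  1 <= lambda * parity_weight R a b k n.
Proof.
move=> n0 nS.
have w0 : 0 <= parity_weight R a b k n.
  by rewrite /parity_weight mulr_ge0 // exprn_ge0 // /a /b; lra.
have := @parity_weight_pow4_ge a b k n.
have -> : 2 <= a ^+ 4 by rewrite /a; lra.
have -> : 2 <= 5 * b ^+ 4 by rewrite /b; lra.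
have -> : 0 <= a by rewrite /a; lra.
have -> : 0 <= b by rewrite /b; lra.
move=> /(_ isT isT isT isT).
have : 5 ^+ odd_steps k n <= lambda * 2 ^+ k.
  rewrite leNgt; apply: contra nS => lt5; rewrite inE; apply/stopping_setP.
  (* If [5 ^ s > lambda * 2 ^ k], time [k] itself is a witness. *)
  split=> //; exists ord_max => /=.
  have n0R : 0 < n%:R :> R by rewrite ltr0n.
  have := iter_T5_ge k n; rewrite -(ler_nat R) !natrM !natrX => ge_it.
  rewrite -(ltr_pM2l (_ : 0 < 2 ^+ k :> R)) ?exprn_gt0 //.
  by apply: lt_le_trans ge_it; rewrite mulrA ltr_pM2r // mulrC.
have t0 : 0 < 2 ^+ k :> R by rewrite exprn_gt0.
move: (parity_weight _ _ _ _ _) w0 (2 ^+ k) t0 (5 ^+ _ : R) => w w0 u u0 v le_v le_u.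
have : 1 <= lambda * w ^+ 4.
  rewrite -(ler_pM2l u0) mulr1 (le_trans le_u) // [u * _]mulrA [u * _]mulrC.
  by rewrite ler_wpM2r // exprn_ge0.
(* From [w ^+ 4] down to [w]: for [w >= 1] use [lambda >= 1], otherwise [w ^+ 4 <= w]. *)
case: (lerP 1 w) => [w1 _|w1 /le_trans]; first by rewrite mulr_ege1.
apply; rewrite ler_wpM2l ?(le_trans _ hlambda) //.
by rewrite exprS ler_piMr // exprn_ile1 // ltW.
Qed.

(** Charge each point [lambda] times its weight: at least 1 if missed, nonnegative otherwise. *)
Lemma stopping_set_window k t : (0 < t)%N ->
  (2 ^ k)%:R - lambda * (a + b) ^+ k <=
  (\sum_(i < 2 ^ k) (t + i \in stopping_set lambda k))%N%:R.
Proof.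
move=> t0; rewrite -(sum_parity_weight R a b k t) mulr_sumr lerBlDr natr_sum -big_split /=.
rewrite -[X in X%:R <= _]card_ord -sum1_card natr_sum; apply: ler_sum => i _.
have w0 : 0 <= lambda * parity_weight R a b k (t + i).
  rewrite mulr_ge0 ?(le_trans _ hlambda) //.
  by rewrite /parity_weight mulr_ge0 // exprn_ge0 // /a /b; lra.
case: (boolP (_ \in _)) => [_|nS]; first by rewrite lerDl.
by rewrite add0r missed_weight // addn_gt0 t0.
Qed.

Lemma stopping_set_density k :
  exists2 D : R, count_ratio R (stopping_set lambda k) @ \oo --> D &
    1 - lambda * ((a + b) / 2) ^+ k <= D.
Proof.
have p0 : (0 < 2 ^ k)%N by rewrite expn_gt0.
have [N perN] := stopping_set_eventually_periodic k.
(* Starting at [N.+1] makes the counted window consist of positive integers. *)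
have perN1 n : (N.+1 <= n)%N -> ((n + 2 ^ k)%N \in stopping_set lambda k) =
    (n \in stopping_set lambda k) by move/ltnW/perN.
eexists; first exact: (count_ratio_periodic R _ _ N.+1 p0 perN1).
rewrite ler_pdivlMr ?ltr0n //; apply: le_trans (stopping_set_window k N.+1 _) => //.
by rewrite mulrBl mul1r -mulrA natrX expr_div_n divfK // expf_neq0 // pnatr_eq0.
Qed.

Lemma error_cvg0 : 1 - lambda * ((a + b) / 2) ^+ k @[k --> \oo] --> (1 : R).
Proof.
rewrite -[X in _ --> X]subr0; apply: cvgB; first exact: cvg_cst.
rewrite -(mulr0 lambda); apply: cvgMr; apply: cvg_expr.
by rewrite ger0_norm /a /b; lra.
Qed.

End StoppingSet.

(** * Passage to the limit and to finite stopping times *)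

Lemma count_ratio_le1 (R : realType) (A : set nat) t : count_ratio R A t <= 1.
Proof.
case: t => [|t]; first by rewrite /count_ratio invr0 mulr0.
rewrite /count_ratio ler_pdivrMr ?ltr0n // mul1r ler_nat.
by rewrite (leq_trans (count_size _ _)) // size_iota.
Qed.

Lemma count_ratio_subset (R : realType) (A B : set nat) t :
  A `<=` B -> count_ratio R A t <= count_ratio R B t.
Proof.
move=> AB; rewrite /count_ratio ler_wpM2r ?invr_ge0 // ler_nat.
by apply: sub_count => n; rewrite !inE; exact: AB.
Qed.

Theorem theorem7p2 (R : realType) (lambda : R) (hlambda : 1 <= lambda) :
  (forall k : nat, (1 <= k)%N ->
     has_natural_density R (stopping_set lambda k)) /\
  (natural_density R (stopping_set lambda k) @[k --> \oo] --> (1 : R)) /\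
  (has_natural_density R (finite_stopping_set lambda) /\
   natural_density R (finite_stopping_set lambda) = 1).
Proof.
have dens := stopping_set_density R lambda hlambda.
have has_dens k : has_natural_density R (stopping_set lambda k).
  by have [D cvD _] := dens k; apply/cvg_ex; exists D.
have lim1 : natural_density R (stopping_set lambda k) @[k --> \oo] --> (1 : R).
  apply: (@squeeze_cvgr _ _ _ _ _ (fun=> 1)); last exact: cvg_cst.
    near=> k; have [D cvD geD] := dens k; apply/andP; split.
      by rewrite /natural_density (cvg_lim _ cvD)//; exact: geD.
    by apply: limr_le; [exact: has_dens|near=> t; exact: count_ratio_le1].
  exact: error_cvg0.
(* The ratio is squeezed between that of one stopping set and 1: first fix [k] with density within
   [e / 2] of 1, then take [t] large. *)
have limF : count_ratio R (finite_stopping_set lambda) @ \oo --> (1 : R).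
  apply/cvgrPdist_le => e e0.
  have /cvgrPdist_le/(_ (e / 2)) := lim1.
  rewrite divr_gt0 // => /(_ isT)[k _ /(_ k (leqnn k))/= hk].
  have /cvgrPdist_le/(_ (e / 2)) := has_dens k.
  rewrite divr_gt0 // => /(_ isT) hS; near=> t.
  have /ler_normlP[_ ht] : `|natural_density R (stopping_set lambda k) -
      count_ratio R (stopping_set lambda k) t| <= e / 2 by near: t; exact: hS.
  move/ler_normlP: hk => [_ hk].
  have SF : stopping_set lambda k `<=` finite_stopping_set lambda.
    by move=> n [n0 le_k]; split=> //; exact: le_lt_trans le_k (ltry _).
  have leSF := count_ratio_subset R _ _ t SF.
  have leF1 := count_ratio_le1 R (finite_stopping_set lambda) t.
  by rewrite ger0_norm; lra.
by do !split=> //; [apply/cvg_ex; exists 1 | exact: cvg_lim limF].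
Unshelve. all: end_near. Qed.
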